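(* Let $f(x,y,z)$ be an invertible polynomial in three variables, of one of the Types I–V, and let $f^t$ be its Berglund–Hübsch transpose. Let $W_f$ and $W_{f^t}$ be the canonical systems of weights attached to $f$ and $f^t$. Then their Gorenstein parameters agree: $$a_{W_f}=a_{W_{f^t}}.$$
   Context: Write $f=\sum_{i=1}^3\prod_{j=1}^3x_j^{E_{ij}}$ with $(x_1,x_2,x_3)=(x,y,z)$; the Berglund–Hübsch transpose is $f^t=\sum_{i=1}^3\prod_{j=1}^3x_j^{E_{ji}}$. The Gorenstein parameter of a system of weights $W=(w_1,w_2,w_3;d)$ is $a_W:=d-w_1-w_2-w_3$. The invertible polynomials in three variables (up to weighted homogeneous coordinate change), their transposes, and the canonical systems of weights $W=(w_1,w_2,w_3;d)$ (not necessarily reduced, i.e. $\gcd(w_1,w_2,w_3,d)$ may be $>1$) are: Type I ($p_1,p_2,p_3\in\mathbb{Z}_{\ge2}$): $f=f^t=x^{p_1}+y^{p_2}+z^{p_3}$; $W_f=W_{f^t}=(p_2p_3,p_3p_1,p_1p_2;p_1p_2p_3)$. Type II ($p_1,p_2,\frac{p_3}{p_2}\in\mathbb{Z}_{\ge2}$): $f=x^{p_1}+y^{p_2}+yz^{p_3/p_2}$, $f^t=x^{p_1}+y^{p_2}z+z^{p_3/p_2}$; $W_f=(p_3,\frac{p_1p_3}{p_2},(p_2-1)p_1;p_1p_3)$, $W_{f^t}=(p_3,(\frac{p_3}{p_2}-1)p_1,p_1p_2;p_1p_3)$. Type III ($p_1\in\mathbb{Z}_{\ge2}$, $q_2,q_3\in\mathbb{Z}_{\ge1}$,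 and $p_2$ defined by $p_2+1=(q_2+1)(q_3+1)$): $f=f^t=x^{p_1}+zy^{q_2+1}+yz^{q_3+1}$; $W_f=W_{f^t}=(p_2,p_1q_3,p_1q_2;p_1p_2)$. Type IV ($p_1,\frac{p_2}{p_1},\frac{p_3}{p_2}\in\mathbb{Z}_{\ge2}$): $f=x^{p_1}+xy^{p_2/p_1}+yz^{p_3/p_2}$, $f^t=x^{p_1}y+y^{p_2/p_1}z+z^{p_3/p_2}$; $W_f=(\frac{p_3}{p_1},(p_1-1)\frac{p_3}{p_2},p_2-p_1+1;p_3)$, $W_{f^t}=(\frac{p_3}{p_1}-\frac{p_3}{p_2}+1,(\frac{p_3}{p_2}-1)p_1,p_2;p_3)$. Type V ($q_1,q_2,q_3\in\mathbb{Z}_{\ge1}$): $f=x^{q_1}y+y^{q_2}z+z^{q_3}x$, $f^t=zx^{q_1}+xy^{q_2}+yz^{q_3}$; $W_f=(q_2q_3-q_3+1,q_3q_1-q_1+1,q_1q_2-q_2+1;q_1q_2q_3+1)$, $W_{f^t}=(q_2q_3-q_2+1,q_3q_1-q_3+1,q_1q_2-q_1+1;q_1q_2q_3+1)$. *)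

(* Defs.v *)
From mathcomp Require Export all_boot all_order all_algebra.
From mathcomp Require Export mpoly.

Set Implicit Arguments.
Unset Strict Implicit.
Unset Printing Implicit Defensive.

Import GRing.Theory.
Local Open Scope ring_scope.

(* The variables (x, y, z) are ('X_0, 'X_1, 'X_2), and the Berglund-Huebsch
   transpose of [poly_of_exponents K E] is [poly_of_exponents K E^T]. *)
Definition poly_of_exponents (K : fieldType) (E : 'M[nat]_3) : {mpoly K[3]} :=
  \sum_(i < 3) \prod_(j < 3) 'X_j ^+ E i j.

(* Not assumed reduced: gcd (w1, w2, w3, d) may be > 1. *)
Record weight_system := WeightSystem { w1 : int; w2 : int; w3 : int; wd : int }.

Definition gorenstein (W : weight_system) : int := wd W - w1 W - w2 W - w3 W.

(* [canonical_weights f W]: f is, literally, one of the polynomials f or f^t of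
   Types I-V, and W is the canonical system of weights of that polynomial.
   The constructors with suffix [t] are the transposes f^t of Types II, IV, V;
   Types I and III are self-transpose.  Every quotient is exact under the
   hypotheses of its constructor, and every subtraction is taken in int. *)
Section CanonicalWeights.
Variable K : fieldType.
Local Notation x := ('X_(0 : 'I_3) : {mpoly K[3]}).
Local Notation y := ('X_(1 : 'I_3) : {mpoly K[3]}).
Local Notation z := ('X_(2%:R : 'I_3) : {mpoly K[3]}).

Inductive canonical_weights : {mpoly K[3]} -> weight_system -> Prop :=
| TypeI (p1 p2 p3 : nat) :
    (2 <= p1)%N -> (2 <= p2)%N -> (2 <= p3)%N ->
    canonical_weights (x ^+ p1 + y ^+ p2 + z ^+ p3)
      (WeightSystem (p2%:Z * p3%:Z) (p3%:Z * p1%:Z) (p1%:Z * p2%:Z)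
                    (p1%:Z * p2%:Z * p3%:Z))
| TypeII (p1 p2 p3 : nat) :
    (2 <= p1)%N -> (2 <= p2)%N -> (p2 %| p3)%N -> (2 <= p3 %/ p2)%N ->
    canonical_weights (x ^+ p1 + y ^+ p2 + y * z ^+ (p3 %/ p2)%N)
      (WeightSystem p3%:Z ((p1 * p3) %/ p2)%N%:Z ((p2%:Z - 1) * p1%:Z)
                    (p1%:Z * p3%:Z))
| TypeIIt (p1 p2 p3 : nat) :
    (2 <= p1)%N -> (2 <= p2)%N -> (p2 %| p3)%N -> (2 <= p3 %/ p2)%N ->
    canonical_weights (x ^+ p1 + y ^+ p2 * z + z ^+ (p3 %/ p2)%N)
      (WeightSystem p3%:Z (((p3 %/ p2)%N%:Z - 1) * p1%:Z) (p1%:Z * p2%:Z)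
                    (p1%:Z * p3%:Z))
| TypeIII (p1 q2 q3 p2 : nat) :
    (2 <= p1)%N -> (1 <= q2)%N -> (1 <= q3)%N ->
    (p2 + 1 = (q2 + 1) * (q3 + 1))%N ->
    canonical_weights (x ^+ p1 + z * y ^+ (q2 + 1) + y * z ^+ (q3 + 1))
      (WeightSystem p2%:Z (p1%:Z * q3%:Z) (p1%:Z * q2%:Z) (p1%:Z * p2%:Z))
| TypeIV (p1 p2 p3 : nat) :
    (2 <= p1)%N -> (p1 %| p2)%N -> (2 <= p2 %/ p1)%N ->
    (p2 %| p3)%N -> (2 <= p3 %/ p2)%N ->
    canonical_weights
      (x ^+ p1 + x * y ^+ (p2 %/ p1)%N + y * z ^+ (p3 %/ p2)%N)
      (WeightSystem (p3 %/ p1)%N%:Z ((p1%:Z - 1) * (p3 %/ p2)%N%:Z)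
                    (p2%:Z - p1%:Z + 1) p3%:Z)
| TypeIVt (p1 p2 p3 : nat) :
    (2 <= p1)%N -> (p1 %| p2)%N -> (2 <= p2 %/ p1)%N ->
    (p2 %| p3)%N -> (2 <= p3 %/ p2)%N ->
    canonical_weights
      (x ^+ p1 * y + y ^+ (p2 %/ p1)%N * z + z ^+ (p3 %/ p2)%N)
      (WeightSystem ((p3 %/ p1)%N%:Z - (p3 %/ p2)%N%:Z + 1)
                    (((p3 %/ p2)%N%:Z - 1) * p1%:Z) p2%:Z p3%:Z)
| TypeV (q1 q2 q3 : nat) :
    (1 <= q1)%N -> (1 <= q2)%N -> (1 <= q3)%N ->
    canonical_weights (x ^+ q1 * y + y ^+ q2 * z + z ^+ q3 * x)
      (WeightSystem (q2%:Z * q3%:Z - q3%:Z + 1) (q3%:Z * q1%:Z - q1%:Z + 1)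
                    (q1%:Z * q2%:Z - q2%:Z + 1) (q1%:Z * q2%:Z * q3%:Z + 1))
| TypeVt (q1 q2 q3 : nat) :
    (1 <= q1)%N -> (1 <= q2)%N -> (1 <= q3)%N ->
    canonical_weights (z * x ^+ q1 + x * y ^+ q2 + y * z ^+ q3)
      (WeightSystem (q2%:Z * q3%:Z - q2%:Z + 1) (q3%:Z * q1%:Z - q3%:Z + 1)
                    (q1%:Z * q2%:Z - q1%:Z + 1) (q1%:Z * q2%:Z * q3%:Z + 1)).

End CanonicalWeights.

(* Main.v *)
Require Import Defs.
From mathcomp Require Import perm ring zify.

(** The canonical weights [w] and degree [d] of a polynomial with exponent matrix
    [A] solve [A w = d 1]: every monomial has degree [d].  The scale of the
    solution is fixed in the same way in all the Types, by [d = |det A|].  By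
    Cramer's rule the sum of the weights is then [sgn (det A)] times the sum of
    the entries of the adjugate of [A], so the Gorenstein parameter is
      [|det A| - sgn (det A) * \sum_i \sum_j (\adj A) i j],
    which is invariant under transposition ([gorenstein_formula]).

    A polynomial determines its exponent matrix only up to a permutation of the
    rows ([exponents_unique]), so the matrix [E] of the theorem need not be the
    matrix [A] that is read off from the list of Types, and [E^T] then differs
    from [A^T] by a permutation of the variables.  No comparison of the Types of
    the two polynomials is needed, however: permuting the rows of a matrix
    preserves both the equations [A w = d 1] and [|det A|]
    ([weights_of_row_perm]), so the formula applies to [E] itself, and likewise
    to [E^T]. *)

Set Implicit Arguments.
Unset Strict Implicit.
Unset Printing Implicit Defensive.

Import GRing.Theory Num.Theory.
Local Open Scope ring_scope.

(** * Weight systems normalised by the determinant *)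

Definition exponent_int (A : 'M[nat]_3) : 'M[int]_3 := map_mx Posz A.

Definition weight_vector (W : weight_system) : 'cV[int]_3 :=
  \col_(i < 3) nth 0 [:: w1 W; w2 W; w3 W] i.

(** The equations say that [W] makes every monomial with exponents in [A]
    homogeneous of degree [wd W], which determines [W] up to scale when [A] is
    nonsingular; the value of [wd W] then fixes the scale. *)
Definition weights_of (A : 'M[nat]_3) (W : weight_system) : Prop :=
  [/\ exponent_int A *m weight_vector W = const_mx (wd W),
      wd W = `|\det (exponent_int A)|
    & \det (exponent_int A) != 0].

Definition mx_of_rows (a b c a' b' c' a'' b'' c'' : nat) : 'M[nat]_3 :=
  \matrix_(i < 3, j < 3)
    nth 0%N (nth [::] [:: [:: a; b; c]; [:: a'; b'; c']; [:: a''; b''; c'']] i) j.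

Lemma big_ord3 (R : Type) (idx : R) (op : Monoid.law idx) (F : 'I_3 -> R) :
  \big[op/idx]_(i < 3) F i = op (F 0) (op (F 1) (F 2%:R)).
Proof.
rewrite !big_ord_recl big_ord0 Monoid.mulm1.
by congr (op (F _) (op (F _) (F _))); apply: val_inj.
Qed.

Lemma poly_of_rows (K : fieldType) a b c a' b' c' a'' b'' c'' :
  let x := 'X_0 : {mpoly K[3]} in
  let y := 'X_1 : {mpoly K[3]} in
  let z := 'X_(2%:R) : {mpoly K[3]} in
  poly_of_exponents K (mx_of_rows a b c a' b' c' a'' b'' c'') =
  x ^+ a * y ^+ b * z ^+ c + x ^+ a' * y ^+ b' * z ^+ c'
    + x ^+ a'' * y ^+ b'' * z ^+ c''.
Proof. by rewrite /poly_of_exponents /= !big_ord3 !mxE /= !mulrA addrA. Qed.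

Lemma det_of_rows (a b c a' b' c' a'' b'' c'' : nat) :
  \det (exponent_int (mx_of_rows a b c a' b' c' a'' b'' c'')) =
  a%:Z * (b'%:Z * c''%:Z - c'%:Z * b''%:Z)
  - b%:Z * (a'%:Z * c''%:Z - c'%:Z * a''%:Z)
  + c%:Z * (a'%:Z * b''%:Z - b'%:Z * a''%:Z).
Proof.
rewrite (expand_det_row _ 0) big_ord3 /cofactor.
rewrite !(expand_det_row (_ : 'M_2) 0) !big_ord_recl !big_ord0 /cofactor.
rewrite !det_mx11 !mxE /= !addn0 !expr0 !expr1; ring.
Qed.

Lemma weights_of_rows (a b c a' b' c' a'' b'' c'' : nat) (u v w d : int) :
    a%:Z * u + b%:Z * v + c%:Z * w = d ->
    a'%:Z * u + b'%:Z * v + c'%:Z * w = d ->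
    a''%:Z * u + b''%:Z * v + c''%:Z * w = d ->
    0 < d ->
    a%:Z * (b'%:Z * c''%:Z - c'%:Z * b''%:Z)
      - b%:Z * (a'%:Z * c''%:Z - c'%:Z * a''%:Z)
      + c%:Z * (a'%:Z * b''%:Z - b'%:Z * a''%:Z) = d ->
  weights_of (mx_of_rows a b c a' b' c' a'' b'' c'') (WeightSystem u v w d).
Proof.
move=> e1 e2 e3 d_gt0 det_eq.
split; rewrite ?det_of_rows ?det_eq /= ?gtr0_norm ?lt0r_neq0 //.
apply/matrixP=> i j; rewrite !mxE big_ord3 !mxE /= addrA.
by case: i => [[|[|[|]]] lt_i3] //=; rewrite ?e1 ?e2 ?e3.
Qed.

(** In each Type the exponents are written row by row; what remains are
    polynomial identities in the parameters, once the exact quotients have been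
    replaced by new parameters. *)
Lemma canonical_weights_from_rows (K : fieldType) (f : {mpoly K[3]}) W :
  canonical_weights f W ->
  exists2 A, f = poly_of_exponents K A & weights_of A W.
Proof.
case=> [p1 p2 p3 h1 h2 h3 | p1 p2 p3 h1 h2 /dvdnP[k ->]
  | p1 p2 p3 h1 h2 /dvdnP[k ->] | p1 q2 q3 p2 h1 h2 h3 p2E
  | p1 p2 p3 h1 /dvdnP[l ->] h2 /dvdnP[k ->]
  | p1 p2 p3 h1 /dvdnP[l ->] h2 /dvdnP[k ->]
  | q1 q2 q3 h1 h2 h3 | q1 q2 q3 h1 h2 h3].
- exists (mx_of_rows p1 0 0 0 p2 0 0 0 p3).
    by rewrite poly_of_rows; ring.
  by apply: weights_of_rows; first [ring | nia].
- have p2_gt0 : (0 < p2)%N by lia.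
  rewrite mulnK // mulnA mulnK // => h3.
  exists (mx_of_rows p1 0 0 0 p2 0 0 1 k).
    by rewrite poly_of_rows; ring.
  by rewrite !PoszM; apply: weights_of_rows; first [ring | nia].
- have p2_gt0 : (0 < p2)%N by lia.
  rewrite mulnK // => h3.
  exists (mx_of_rows p1 0 0 0 p2 1 0 0 k).
    by rewrite poly_of_rows; ring.
  by rewrite !PoszM; apply: weights_of_rows; first [ring | nia].
- have {p2E} -> : p2%:Z = (q2%:Z + 1) * (q3%:Z + 1) - 1 by lia.
  exists (mx_of_rows p1 0 0 0 (q2 + 1) 1 0 1 (q3 + 1)).
    by rewrite poly_of_rows; ring.
  by apply: weights_of_rows; rewrite ?PoszD; first [ring | nia].
- have p1_gt0 : (0 < p1)%N by lia.
  rewrite mulnK // in h2 *.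
  have p2_gt0 : (0 < l * p1)%N by nia.
  rewrite mulnK // mulnA mulnK // => h3.
  exists (mx_of_rows p1 0 0 1 l 0 0 1 k).
    by rewrite poly_of_rows; ring.
  by rewrite !PoszM; apply: weights_of_rows; first [ring | nia].
- have p1_gt0 : (0 < p1)%N by lia.
  rewrite mulnK // in h2 *.
  have p2_gt0 : (0 < l * p1)%N by nia.
  rewrite mulnK // mulnA mulnK // => h3.
  exists (mx_of_rows p1 1 0 0 l 1 0 0 k).
    by rewrite poly_of_rows; ring.
  by rewrite !PoszM; apply: weights_of_rows; first [ring | nia].
- exists (mx_of_rows q1 1 0 0 q2 1 1 0 q3).
    by rewrite poly_of_rows; ring.
  by apply: weights_of_rows; first [ring | nia].
- exists (mx_of_rows q1 0 1 1 q2 0 0 1 q3).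
    by rewrite poly_of_rows; ring.
  by apply: weights_of_rows; first [ring | nia].
Qed.

(** * The Gorenstein parameter in terms of the adjugate *)

(** Multiplying [A w = d 1] by the adjugate gives [det A *: w = d *: (\adj A 1)],
    and [d = sgn (det A) * det A]; summing the coordinates and cancelling
    [det A] gives the sum of the weights. *)
Lemma gorenstein_formula A W : weights_of A W ->
  let M := exponent_int A in
  gorenstein W = `|\det M| - Num.sg (\det M) * \sum_i \sum_j (\adj M) i j.
Proof.
case=> Aw dE det_n0 /=; rewrite /gorenstein dE -!addrA -!opprD; congr (_ - _).
apply: (mulfI det_n0); set M := exponent_int A in Aw dE det_n0 *.
have cramer : \det M *: weight_vector W = wd W *: (\adj M *m const_mx 1).
  rewrite -mul_scalar_mx -mul_adj_mx -mulmxA Aw scalemxAr.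
  by congr (_ *m _); apply/matrixP=> i j; rewrite !mxE mulr1.
have -> : w1 W + (w2 W + w3 W) = \sum_i weight_vector W i 0.
  by rewrite big_ord3 !mxE.
transitivity (\sum_i (\det M *: weight_vector W) i 0).
  by rewrite mulr_sumr; apply: eq_bigr => i _; rewrite [RHS]mxE.
rewrite cramer dE mulrA [_ * Num.sg _]mulrC -normrEsg mulr_sumr.
apply: eq_bigr => i _; rewrite !mxE; congr (_ * _).
by apply: eq_bigr => j _; rewrite [const_mx _ _ _]mxE mulr1.
Qed.

(** * Uniqueness of the exponent matrix *)

Lemma mcoeff_poly_of_exponents (K : fieldType) (A : 'M[nat]_3) m :
  (poly_of_exponents K A)@_m = \sum_i ([multinom A i j | j < 3] == m)%:R.
Proof.
rewrite /poly_of_exponents raddf_sum /=; apply: eq_bigr => i _.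
rewrite -mcoeffX; congr (_@_m); rewrite mpolyXE_id.
by apply: eq_bigr => j _; rewrite mnmE.
Qed.

(** When the rows of [A] are distinct, each of its monomials has coefficient 1 in
    the polynomial, in any characteristic, so it must also occur among the rows of
    [B].  Since both matrices have three rows, this injection of the rows of [A]
    into those of [B] is a permutation.  Without distinct rows coefficients could
    cancel in positive characteristic. *)
Lemma exponents_unique (K : fieldType) (A B : 'M[nat]_3) :
  injective (fun i => row i A) ->
  poly_of_exponents K A = poly_of_exponents K B ->
  exists s : 'S_3, A = row_perm s B.
Proof.
move=> row_inj eqAB.
have /fin_all_exists[t rowE] i : exists k, row k B = row i A.
  apply/'exists_eqP; apply: contraT; rewrite negb_exists => /forallP noB.
  pose m := [multinom A i j | j < 3].
  have mE (C : 'M_3) k : ([multinom C k j | j < 3] == m) = (row k C == row i A).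
    apply/eqP/eqP => [/mnmP eqm | /rowP eqr].
      by apply/rowP=> j; have := eqm j; rewrite !mxE !mnmE.
    by apply/mnmP=> j; have := eqr j; rewrite !mxE !mnmE.
  (* If row [i] of [A] is not a row of [B], the coefficient of its monomial is 1
     on the left-hand side and 0 on the right-hand side. *)
  have := congr1 (mcoeff m) eqAB; rewrite !mcoeff_poly_of_exponents.
  rewrite (bigD1 i) //= eqxx !big1 ?addr0 => [/eqP | k _ | k ne_ki].
  - by rewrite oner_eq0.
  - by rewrite mE (negbTE (noB k)).
  by rewrite mE (inj_eq row_inj) (negbTE ne_ki).
have t_inj : injective t.
  by move=> i j eq_t; apply: row_inj; rewrite -!rowE eq_t.
exists (perm t_inj); apply/row_matrixP=> i.
by rewrite -rowE; apply/rowP=> j; rewrite !mxE permE.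
Qed.

Lemma weights_of_row_perm s (A : 'M[nat]_3) W :
  weights_of (row_perm s A) W -> weights_of A W.
Proof.
rewrite /weights_of /exponent_int map_row_perm row_permE.
rewrite det_mulmx det_perm normrM normr_sign mul1r mulf_eq0 signr_eq0 /=.
case=> Aw dE det_n0; split=> //.
have perm_unit : (perm_mx s : 'M[int]_3) \in unitmx by exact: unitmx_perm.
apply: (can_inj (mulKmx perm_unit)); rewrite mulmxA Aw -row_permE.
by apply/matrixP=> i j; rewrite !mxE.
Qed.

Lemma injective_row_of_det (A : 'M[nat]_3) :
  \det (exponent_int A) != 0 -> injective (fun i => row i A).
Proof.
move=> det_n0 i j eq_row; apply/eqP; apply: contraNT det_n0 => ne_ij.
apply/eqP/(determinant_alternate ne_ij) => k.
by have /rowP/(_ k) := eq_row; rewrite !mxE => ->.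
Qed.

(** Any exponent matrix of a canonical polynomial may be used in place of the one
    read off from its Type. *)
Lemma weights_of_canonical_poly (K : fieldType) (E : 'M[nat]_3) W :
  canonical_weights (poly_of_exponents K E) W -> weights_of E W.
Proof.
case/canonical_weights_from_rows => A eqEA wA.
have [_ _ /injective_row_of_det row_inj] := wA.
have [s def_A] := exponents_unique row_inj (esym eqEA).
by apply: (@weights_of_row_perm s); rewrite -def_A.
Qed.

(** * Invariance under transposition *)

Theorem theorem18 (K : fieldType) (E : 'M[nat]_3) (Wf Wft : weight_system)
    (hf : canonical_weights (poly_of_exponents K E) Wf)
    (hft : canonical_weights (poly_of_exponents K E^T) Wft) :
  gorenstein Wf = gorenstein Wft.
Proof.
rewrite (gorenstein_formula (weights_of_canonical_poly hf)).
rewrite (gorenstein_formula (weights_of_canonical_poly hft)).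
rewrite /exponent_int -map_trmx det_tr -trmx_adj exchange_big /=.
congr (_ - _ * _); apply: eq_bigr => i _.
by apply: eq_bigr => j _; rewrite [RHS]mxE.
Qed.
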